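(* For every integer $d\ge 3$, $$(d!)^{\frac{1}{2d}}>d^{\frac14}.$$ *)

(* Defs.v *)
(* Standard-library world: the classical real numbers R. *)
From Stdlib Require Import Arith Factorial Reals.

(* Main.v *)
(* Taking logarithms, the claim is [d ^ d < (d!) ^ 2]. This goes by induction on [d] from
   [27 < 36]; the step needs [(1 + 1/d) ^ d <= d + 1]. *)
Require Import Defs.
From Stdlib Require Import Arith Factorial Reals Lia Lra.
Open Scope R_scope.

Lemma pow_succ_base_le (d k : nat) :
  (k <= d)%nat -> (S d ^ k <= S k * d ^ k)%nat.
Proof.
  induction k as [|k IH]; intros Hk; [simpl; lia|].
  specialize (IH ltac:(lia)).
  rewrite !Nat.pow_succ_r'.
  generalize dependent (S d ^ k)%nat; generalize (d ^ k)%nat; intros; nia.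
Qed.

Lemma pow_self_lt_fact_sqr (d : nat) :
  (3 <= d)%nat -> (d ^ d < fact d * fact d)%nat.
Proof.
  induction 1 as [|d Hd IH]; [simpl; lia|].
  pose proof (pow_succ_base_le d d (le_n d)) as H.
  rewrite Nat.pow_succ_r', fact_simpl.
  apply Nat.le_lt_trans with (S d * S d * d ^ d)%nat; nia.
Qed.

Theorem lemma3p2 (d : nat) (hd : (3 <= d)%nat) :
  Rpower (INR (fact d)) (1 / (2 * INR d)) > Rpower (INR d) (1 / 4).
Proof.
  assert (Hd : 0 < INR d) by (apply lt_0_INR; lia).
  pose proof (INR_fact_lt_0 d) as Hf.
  assert (H : INR d * ln (INR d) < 2 * ln (INR (fact d))).
  { pose proof (lt_INR _ _ (pow_self_lt_fact_sqr d hd)) as H.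
    rewrite pow_INR, mult_INR in H.
    apply ln_increasing in H; [|now apply pow_lt].
    rewrite ln_pow, ln_mult in H by assumption.
    lra. }
  apply exp_increasing.
  apply Rmult_lt_reg_l with (4 * INR d); [lra|].
  replace (4 * INR d * (1 / 4 * ln (INR d))) with (INR d * ln (INR d)) by field.
  replace (4 * INR d * (1 / (2 * INR d) * ln (INR (fact d))))
    with (2 * ln (INR (fact d))) by (field; lra).
  exact H.
Qed.
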